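(* Let $d\ge 1$ be an integer. For $i=1,\dots,d+1$ let $n_i\ge 2$ be an integer, $\delta_i\in\mathbb{R}^d$, and let $\vec{\mathbf a}_i$ be an infinite sequence of vectors in $\{0,1,\dots,n_i-1\}^d$ with associated location function $\mathcal{L}_{\vec{\mathbf a}_i}$. Let $\mathcal{G}_i:=\mathcal{G}(n_i,\delta_i,\mathcal{L}_{\vec{\mathbf a}_i})$ be the corresponding general dyadic grid with base $n_i$ on $\mathbb{R}^d$, and let $\mathcal{N}:=\{n_1,\dots,n_{d+1}\}$. Then $\mathcal{G}_1,\dots,\mathcal{G}_{d+1}$ are adjacent if and only if the following two conditions hold: (1) for any $\ell_1,\ell_2\in\{1,\dots,d+1\}$ with $\ell_1\ne\ell_2$ and any $s\in\{1,\dots,d\}$, the real number $(\delta_{\ell_1})_s-(\delta_{\ell_2})_s$ is an $(n_{\ell_1},n_{\ell_2})$-far number with respect to $\mathcal{N}$; (2) for any $\ell_3,\ell_4\in\{1,\dots,d+1\}$ with $\ell_3\neq\ell_4$ and any $s\in\{1,\dots,d\}$, the pair of integer-valued functions $\left(\left[\mathcal{L}_{\vec{\mathbf a}_{\ell_3}}(\cdot)\right]_s,\left[\mathcal{L}_{\vec{\mathbf a}_{\ell_4}}(\cdot)\right]_s\right)$ is an $(n_{\ell_3},n_{\ell_4})$-far pair of integer-valued functions with respect to $\mathcal{N}$.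
   Context: Conventions: $\mathbb{N}=\{0,1,2,\dots\}$. For $v\in\mathbb{R}^d$, $(v)_s$ or $[v]_s$ denotes its $s$-th component. All cubes have sides parallel to the coordinate axes; $\ell(Q)$ is the sidelength of $Q$. Auxiliary function: for integers $n,n'\ge 2$, $\phi_{n;n'}:\mathbb{N}\to\mathbb{N}$ is $\phi_{n;n'}(j):=\left\lfloor \frac{j\log n}{\log n'}\right\rfloor$. General dyadic grid with base $n$ ($n\ge 2$ an integer): a collection $\mathcal{G}$ of left-closed, right-open cubes $[a_1,a_1+\ell)\times\dots\times[a_d,a_d+\ell)$ in $\mathbb{R}^d$ such that (i) every $Q\in\mathcal{G}$ has sidelength $n^k$ for some $k\in\mathbb{Z}$; (ii) $Q\cap R\in\{Q,R,\emptyset\}$ for all $Q,R\in\mathcal{G}$; (iii) for each $k\in\mathbb{Z}$, the cubes of $\mathcal{G}$ of sidelength $n^k$ form a partition of $\mathbb{R}^d$. Location function: for $\vec{\mathbf a}=\{\vec a_0,\vec a_1,\dots\}$ with $\vec a_j\in\{0,1,\dots,n-1\}^d$ for all $j\ge 0$, define $\mathcal{L}_{\vec{\mathbf a}}:\mathbb{N}\to\mathbb{Z}^d$ by $\mathcal{L}_{\vec{\mathbf a}}(0)=\vec 0$ and $\mathcal{L}_{\vec{\mathbf a}}(j)=\sum_{i=0}^{j-1}n^i\vec a_i$ for $j\ge 1$. The grid $\mathcal{G}(n,\delta,\mathcal{L}_{\vec{\mathbf a}})$ (for $\delta\in\mathbb{R}^d$): the collection of all cubes in the following generations. For $m\ge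 0$, the $m$-th generation consists of the cubes $\prod_{t=1}^d\left[(\delta)_t+\frac{k_t}{n^m},(\delta)_t+\frac{k_t+1}{n^m}\right)$, $(k_1,\dots,k_d)\in\mathbb{Z}^d$. For $m<0$, the $m$-th generation consists of the cubes $\prod_{t=1}^d\left[(\delta)_t+[\mathcal{L}_{\vec{\mathbf a}}(-m)]_t+\frac{k_t}{n^m},(\delta)_t+[\mathcal{L}_{\vec{\mathbf a}}(-m)]_t+\frac{k_t+1}{n^m}\right)$, $(k_1,\dots,k_d)\in\mathbb{Z}^d$. This is a general dyadic grid with base $n$. Adjacency: general dyadic grids $\mathcal{G}_1,\dots,\mathcal{G}_{d+1}$ on $\mathbb{R}^d$ with bases $n_1,\dots,n_{d+1}$ are adjacent if there is a constant $C>0$, independent of the cubes $Q$ and $D$ below, such that for every open cube $Q\subseteq\mathbb{R}^d$ there exist $i\in\{1,\dots,d+1\}$ and $D\in\mathcal{G}_i$ with $Q\subseteq D$ and $\ell(D)\le C\,\ell(Q)$. Far number: let $\mathcal{N}=\{n_1,\dots,n_L\}$ be a collection of integers $\ge 2$, and $n,n'\ge 2$ integers. A real number $\delta$ is an $(n,n')$-far number with respect to $\mathcal{N}$ if there exists $C>0$ such that for every $n_\ell\in\mathcal{N}$, every integer $m\ge 0$ and all $k_1,k_2\in\mathbb{Z}$, $$\left|\delta-\frac{k_1}{n^{\phi_{n_\ell;n}(m)}}-\frac{k_2}{(n')^{\phi_{n_\ell;n'}(m)}}\right|\ge\frac{C}{n_\ell^m}.$$ (The constant $C$ does not depend on $m,k_1,k_2$.)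 Far pair: with $\mathcal{N},n,n'$ as in the previous definition, a pair $(\mathcal{L},\mathcal{L}')$ of functions $\mathbb{N}\to\mathbb{N}$ is an $(n,n')$-far pair of integer-valued functions with respect to $\mathcal{N}$ if there exist $C'>0$ and $J\in\mathbb{N}$ (sufficiently large) such that for every $n_\ell\in\mathcal{N}$, every $j\ge J$ and all $k_3,k_4\in\mathbb{Z}$, $$\left|\mathcal{L}(\phi_{n_\ell;n}(j))+k_3\,n^{\phi_{n_\ell;n}(j)}-\mathcal{L}'(\phi_{n_\ell;n'}(j))-k_4\,(n')^{\phi_{n_\ell;n'}(j)}\right|\ge C'n_\ell^j.$$ (The constant $C'$ does not depend on $j,k_3,k_4$.) *)

(* Defs.v *)
From mathcomp Require Import all_boot all_order all_algebra.
From mathcomp Require Import classical_sets reals exp.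

Set Implicit Arguments.
Unset Strict Implicit.
Unset Printing Implicit Defensive.

Import Order.TTheory GRing.Theory Num.Theory.

Local Open Scope classical_set_scope.
Local Open Scope ring_scope.

(* phi_{n;n'}(j) = floor (j log n / log n').  [Num.truncn] is the nat-valued
   floor of a nonnegative real; the argument is nonnegative for n, n' >= 2. *)
Definition phi (R : realType) (n n' j : nat) : nat :=
  Num.truncn (j%:R * ln (n%:R : R) / ln (n'%:R : R)).

(* A cube with sides parallel to the axes is given by its lower corner and its
   sidelength; the half-open and the open cube with these data are the two
   point sets below.  For d >= 1 either set determines the corner and side. *)
Record cube (R : realType) (d : nat) := Cube {
  corner : 'rV[R]_d;
  side : R;
  side_gt0 : 0 < side }.

Definition halfopen_cube (R : realType) (d : nat) (Q : cube R d) :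
    set 'rV[R]_d :=
  [set x | forall s, corner Q 0 s <= x 0 s < corner Q 0 s + side Q].

Definition open_cube (R : realType) (d : nat) (Q : cube R d) :
    set 'rV[R]_d :=
  [set x | forall s, corner Q 0 s < x 0 s < corner Q 0 s + side Q].

Definition location (d n : nat) (a : nat -> 'rV['I_n]_d) (j : nat) :
    'rV[int]_d :=
  \sum_(i < j) (n ^ i)%N%:Z *: map_mx (fun c : 'I_n => (c : nat)%:Z) (a i).

Definition grid_origin (R : realType) (d : nat) (delta : 'rV[R]_d)
    (L : nat -> 'rV[int]_d) (m : int) : 'rV[R]_d :=
  if 0 <= m then delta else delta + map_mx intr (L `|m|%N).

(* The exponent m is an integer: generation m has sidelength n^(-m). *)
Definition grid (R : realType) (d n : nat) (delta : 'rV[R]_d)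
    (L : nat -> 'rV[int]_d) : set (cube R d) :=
  [set Q | exists (m : int) (k : 'rV[int]_d),
     (forall t, corner Q 0 t =
        grid_origin delta L m 0 t + (k 0 t)%:~R / n%:R ^ m)
     /\ side Q = 1 / n%:R ^ m].

(* The cubes of the collections G i are half-open. *)
Definition adjacent (R : realType) (d : nat) (G : 'I_d.+1 -> set (cube R d)) :
    Prop :=
  exists2 C : R, 0 < C &
    forall Q : cube R d, exists (i : 'I_d.+1) (D : cube R d),
      [/\ G i D, open_cube Q `<=` halfopen_cube D & side D <= C * side Q].

Definition far_number (R : realType) (N : seq nat) (n n' : nat) (delta : R) :
    Prop :=
  exists2 C : R, 0 < C &
    forall nl, nl \in N -> forall (m : nat) (k1 k2 : int),
      `|delta - k1%:~R / n%:R ^+ phi R nl n m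
              - k2%:~R / n'%:R ^+ phi R nl n' m| >= C / nl%:R ^+ m.

Definition far_pair (R : realType) (N : seq nat) (n n' : nat)
    (L L' : nat -> int) : Prop :=
  exists (C' : R) (J : nat), 0 < C' /\
    forall nl, nl \in N -> forall (j : nat), (J <= j)%N ->
    forall (k3 k4 : int),
      `|L (phi R nl n j) + k3 * n%:Z ^+ phi R nl n j
        - L' (phi R nl n' j) - k4 * n'%:Z ^+ phi R nl n' j|%:~R
      >= C' * nl%:R ^+ j.

(* Main.v *)
Require Import Defs.
From mathcomp Require Import all_boot all_order all_algebra perm ring lra.
From mathcomp Require Import boolp classical_sets reals exp.
Set Implicit Arguments.
Unset Strict Implicit.
Unset Printing Implicit Defensive.
Import Order.TTheory GRing.Theory Num.Theory.
Local Open Scope classical_set_scope.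
Local Open Scope ring_scope.

(** The condition that governs everything is the separation of walls: fix one
generation for each grid, and call a wall a hyperplane that carries faces of the
cubes of that generation. A cube Q fails to lie in a grid cube of that generation
exactly when a wall of the grid cuts Q.

If walls of different grids that are orthogonal to the same axis are always at
distance at least r, then a cube of side at most r lies in a cube of one of the
grids: otherwise each of the d+1 grids would cut it in one of the d coordinates,
and two grids would do so in the same coordinate, with walls too close to each
other ([cube_in_grid_of_walls_apart]).

Conversely, let two grids have walls x and y orthogonal to the axis s and at
distance less than r. There is a cube of side r that both walls cut. Its
d-1 remaining coordinates are free, and one can use each of them to let a wall of
one of the d-1 remaining grids cut the cube. All these walls are also walls of
the finer generations, because the location functions make the grids nested, so
no grid cube of these generations contains the cube. Adjacency with
constant C excludes this as soon as every grid cube of side at most C r belongs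
to these finer generations ([walls_apart_of_adjacent]).

The two arithmetic conditions are the separation of walls, written out at a scale
common to all grids. By the definition of phi, n'^phi(j) <= n^j < n'^(phi(j)+1)
([phi_itv]), so the cubes of generation phi(m) have side comparable with nl^(-m)
in all grids at once, and the far number condition says that the walls of these
generations are at distance at least c nl^(-m) ([walls_apart_fineP]). Likewise
the far pair condition concerns the cubes of generation -phi(j), of side
comparable with nl^j; there the walls are displaced by the location functions,
and the contribution of the delta's is bounded, hence negligible for large j
([walls_apart_coarseP]). In the sufficiency direction a single nl gives
arbitrarily small and arbitrarily large scales, and the finitely many scales
in between only affect the constant. *)

(** * Walls of a grid *)

(** The remaining digits of the location function are multiples of n^i: this is
what makes the generations of a grid nested. *)
Lemma location_congr (d n : nat) (a : nat -> 'rV['I_n]_d) (s : 'I_d) (i j : nat) :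
  (i <= j)%N ->
  exists c : int, location a j 0 s = location a i 0 s + n%:Z ^+ i * c.
Proof.
move=> /subnK <-; elim: (j - i)%N => [|p [c IH]]; first by exists 0; rewrite mulr0 addr0.
exists (c + n%:Z ^+ p * (a (p + i)%N 0 s : nat)%:Z).
rewrite addSn /location big_ord_recr mxE -/(location a (p + i)) IH !mxE mulrDr addrA.
by rewrite mulrA -exprD addnC -!natz natrX.
Qed.

(** A hyperplane orthogonal to the axis [s] carries faces of cubes of generation [m]
when its coordinate [x] is such. Stated through integrality of the rescaled offset,
a change of generation uses only the closure of the integers under ring operations. *)
Definition on_wall (R : realType) (d n : nat) (delta : 'rV[R]_d)
    (L : nat -> 'rV[int]_d) (m : int) (s : 'I_d) (x : R) : bool :=
  (x - grid_origin delta L m 0 s) * n%:R ^ m \is a Num.int.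

Lemma natr_exp_int (R : realType) (n k : nat) : (n%:R : R) ^+ k \is a Num.int.
Proof. by rewrite -natrX. Qed.

(** Origins are displaced by integers below generation 0, and by multiples of
n^(-m') between two negative generations; both are multiples of the finer
sidelength. *)
Lemma grid_origin_shift (R : realType) (d n : nat) (delta : 'rV[R]_d)
    (a : nat -> 'rV['I_n]_d) (s : 'I_d) (m m' : int) : (2 <= n)%N -> m <= m' ->
  on_wall n delta (location a) m' s (grid_origin delta (location a) m 0 s).
Proof.
move=> n2; rewrite /on_wall /grid_origin.
have n0 : (n%:R : R) != 0 by rewrite pnatr_eq0 -lt0n (leq_trans _ n2).
case: m m' => [p|p] [q|q] // le_mm' /=; rewrite ?mxE.
- by rewrite subrr mul0r.
- by rewrite [_ - _]addrC addKr; apply: rpredM; [exact: intr_int | exact: natr_exp_int].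
- have /(location_congr a s)[c ->] : (q.+1 <= p.+1)%N by case: p q le_mm'=> [|p] [|q].
  rewrite opprD addrACA subrr add0r intrD [X in X - _]addrC addrK rmorphM /= rmorphXn /=.
  by rewrite mulrC mulrA mulVf ?mul1r ?expf_neq0.
Qed.

Lemma on_wall_refine (R : realType) (d n : nat) (delta : 'rV[R]_d)
    (a : nat -> 'rV['I_n]_d) (s : 'I_d) (m m' : int) (x : R) : (2 <= n)%N -> m <= m' ->
  on_wall n delta (location a) m s x -> on_wall n delta (location a) m' s x.
Proof.
move=> n2 le_mm' xm; have n0 : (n%:R : R) != 0 by rewrite pnatr_eq0 -lt0n (leq_trans _ n2).
have := grid_origin_shift delta a s n2 le_mm'; rewrite /on_wall in xm *.
set o := grid_origin _ _ m _ _ in xm *; set o' := grid_origin _ _ _ _ _ => oo'.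
have -> : x - o' = (x - o) + (o - o') by rewrite addrA subrK.
rewrite mulrDl rpredD //.
have -> : m' = m + `|m' - m|%N by rewrite gez0_abs ?subr_ge0 // subrKC.
by rewrite expfzDr // mulrA; apply: rpredM => //; exact: natr_exp_int.
Qed.

Definition walls_apart (R : realType) (d : nat) (n : 'I_d.+1 -> nat)
    (delta : 'I_d.+1 -> 'rV[R]_d) (L : 'I_d.+1 -> nat -> 'rV[int]_d)
    (g : 'I_d.+1 -> int) (r : R) (l1 l2 : 'I_d.+1) (s : 'I_d) : Prop :=
  forall x y : R, on_wall (n l1) (delta l1) (L l1) (g l1) s x ->
    on_wall (n l2) (delta l2) (L l2) (g l2) s y -> r <= `|x - y|.

(** * Separated walls give covering cubes *)

(** In each coordinate take the last wall that is not beyond the corner of [Q]; if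
the next wall does not cut [Q], then [Q] lies between the two. *)
Lemma cube_in_grid_or_cut (R : realType) (d n : nat) (delta : 'rV[R]_d)
    (L : nat -> 'rV[int]_d) (m : int) (Q : cube R d) : (2 <= n)%N ->
  (exists D : cube R d, [/\ grid n delta L D, open_cube Q `<=` halfopen_cube D
                          & side D = 1 / n%:R ^ m])
  \/ exists (s : 'I_d) (x : R), on_wall n delta L m s x /\
       corner Q 0 s < x < corner Q 0 s + side Q.
Proof.
move=> n2; have n0 : 0 < (n%:R : R) by rewrite ltr0n (leq_trans _ n2).
have N0 : 0 < (n%:R : R) ^ m by exact: exprz_gt0.
set N := n%:R ^ m in N0 *.
pose o := grid_origin delta L m.
pose k : 'rV[int]_d := \row_s Num.floor ((corner Q 0 s - o 0 s) * N).
pose x s := o 0 s + (k 0 s + 1)%:~R / N.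
have xk s : o 0 s + (k 0 s)%:~R / N <= corner Q 0 s < x s.
  have := floor_itv ((corner Q 0 s - o 0 s) * N).
  rewrite /x /k mxE -!lerBrDl -!ltrBlDl ler_pdivrMr // ltr_pdivlMr //.
case: (boolP [forall s, corner Q 0 s + side Q <= x s]) => [/forallP inD|].
  left; have D0 : 0 < 1 / N by rewrite divr_gt0.
  exists (@Cube R d (\row_s (o 0 s + (k 0 s)%:~R / N)) (1 / N) D0); split => //.
    by exists m, k; split=> // t; rewrite mxE.
  move=> y Qy s /=; rewrite mxE.
  have /andP[yl yr] := Qy s; have xks := xk s; have xs := inD s.
  move: xks xs; rewrite /x intrD mulrDl => /andP[h1 h2] h3.
  by apply/andP; split; lra.
rewrite negb_forall => /existsP[s]; rewrite -ltNge => xs.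
right; exists s, (x s); split; last by case/andP: (xk s) => _ ->.
by rewrite /on_wall -/(o) /x addrAC subrr add0r divfK ?intr_int ?gt_eqF.
Qed.

(** Pigeonhole principle: if no grid had such a cube, each of the d+1 grids would cut
[Q] in one of d coordinates. *)
Lemma cube_in_grid_of_walls_apart (R : realType) (d : nat) (n : 'I_d.+1 -> nat)
    (delta : 'I_d.+1 -> 'rV[R]_d) (L : 'I_d.+1 -> nat -> 'rV[int]_d)
    (g : 'I_d.+1 -> int) (r : R) (Q : cube R d) :
  (forall i, (2 <= n i)%N) ->
  (forall l1 l2 s, l1 != l2 -> walls_apart n delta L g r l1 l2 s) ->
  side Q <= r ->
  exists (i : 'I_d.+1) (D : cube R d),
    [/\ grid (n i) (delta i) (L i) D, open_cube Q `<=` halfopen_cube D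
      & side D = 1 / (n i)%:R ^ g i].
Proof.
move=> n2 apart Qr.
apply: contrapT => none.
have cut i : exists s x, on_wall (n i) (delta i) (L i) (g i) s x /\
    corner Q 0 s < x < corner Q 0 s + side Q.
  case: (cube_in_grid_or_cut (delta i) (L i) (g i) Q (n2 i)) => // Di.
  by case: none; exists i.
have {cut} [f cut] := fin_all_exists cut.
(* Two of the d+1 grids cut Q in the same one of its d coordinates. *)
have /injectivePn[i [j neq_ij fij]] : ~~ injectiveb f.
  by apply/negP => /injectiveP /leq_card; rewrite !card_ord ltnn.
have [[x [xw /andP[x1 x2]]] [y [yw /andP[y1 y2]]]] := (cut i, cut j).
rewrite -fij in yw y1 y2.
have := apart i j (f i) neq_ij x y xw yw.
by case: (ger0P (x - y)) => _ h; lra.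
Qed.

(** * Adjacency separates walls *)

(** If [D] contained [Q], it would contain points of [Q] on the wall and points
before it. The wall would then lie strictly between two consecutive walls, those
that bound [D]. *)
Lemma wall_cuts_cube (R : realType) (d n : nat) (delta : 'rV[R]_d)
    (L : nat -> 'rV[int]_d) (m : int) (k : 'rV[int]_d) (Q D : cube R d) (s : 'I_d) (x : R) :
  (2 <= n)%N -> on_wall n delta L m s x ->
  corner Q 0 s < x < corner Q 0 s + side Q ->
  corner D 0 s = grid_origin delta L m 0 s + (k 0 s)%:~R / n%:R ^ m ->
  side D = 1 / n%:R ^ m -> ~ open_cube Q `<=` halfopen_cube D.
Proof.
move=> n2 /intrP[c xc] /andP[x1 x2] Dk Ds QD.
have n0 : 0 < (n%:R : R) by rewrite ltr0n (leq_trans _ n2).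
have N0 : 0 < (n%:R : R) ^ m by exact: exprz_gt0.
have N1 : 0 < (n%:R ^ m)^-1 :> R by rewrite invr_gt0.
have Q0 := side_gt0 Q.
(* Projected to the s-th axis, the inclusion is one of intervals. *)
have at_ y : corner Q 0 s < y < corner Q 0 s + side Q ->
    corner D 0 s <= y < corner D 0 s + side D.
  move=> Qy; pose p := \row_t (if t == s then y else corner Q 0 t + side Q / 2).
  have /QD/(_ s) : open_cube Q p; last by rewrite mxE eqxx.
  move=> t; rewrite mxE; case: eqVneq => [->//|_].
  by apply/andP; split; lra.
have xE : x = grid_origin delta L m 0 s + c%:~R / n%:R ^ m.
  by rewrite -xc mulfK ?gt_eqF // subrKC.
have /at_ /andP[y1 y2] : corner Q 0 s < (corner Q 0 s + x) / 2 < corner Q 0 s + side Q.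
  by apply/andP; split; lra.
have /at_ /andP[z1 z2] : corner Q 0 s < x < corner Q 0 s + side Q by rewrite x1.
have lt1 : (k 0 s)%:~R < c%:~R :> R.
  rewrite -(ltr_pM2r N1); have : corner D 0 s < x by lra.
  by rewrite Dk xE ltrD2l.
have lt2 : c%:~R < (k 0 s + 1)%:~R :> R.
  rewrite -(ltr_pM2r N1) intrD mulrDl; rewrite Dk Ds {1}xE in z2; lra.
by move: lt1 lt2; rewrite !ltr_int ltzD1 => /lt_le_trans h /h; rewrite ltxx.
Qed.

(** Were [x] and [y] closer than [r], a cube of side [r] could be placed so that all
the grids cut it: those of [l1] and [l2] in the coordinate [s], and each other
grid in a coordinate of its own. The hypothesis on [g] says that grid cubes of
side at most [C * r] belong to generation [g i] or a finer one. *)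
Lemma walls_apart_of_adjacent (R : realType) (d : nat) (n : 'I_d.+1 -> nat)
    (delta : 'I_d.+1 -> 'rV[R]_d) (a : forall i : 'I_d.+1, nat -> 'rV['I_(n i)]_d)
    (C r : R) (g : 'I_d.+1 -> int) (l1 l2 : 'I_d.+1) (s : 'I_d) :
  (forall i, (2 <= n i)%N) ->
  (forall Q : cube R d, exists (i : 'I_d.+1) (D : cube R d),
    [/\ grid (n i) (delta i) (location (a i)) D, open_cube Q `<=` halfopen_cube D
      & side D <= C * side Q]) ->
  0 < r ->
  (forall i m, 1 / (n i)%:R ^ m <= C * r -> g i <= m) ->
  l1 != l2 -> walls_apart n delta (fun i => location (a i)) g r l1 l2 s.
Proof.
move=> n2 adj r0 gP l12 x y xw yw; rewrite leNgt; apply/negP=> xy.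
have [j2 l2E _] := unlift_some l12.
(* A bijection from the coordinates to the grids other than l1, sending s to l2:
   lift l1 is a bijection onto these grids, and the transposition corrects it. *)
pose idx (t : 'I_d) := lift l1 (tperm j2 s t).
pose o t := grid_origin (delta (idx t)) (location (a (idx t))) (g (idx t)) 0 t.
pose c : 'rV[R]_d := \row_t ((if t == s then (x + y) / 2 else o t) - r / 2).
have [i [D [GD QD Dr]]] := adj (Cube c r0).
have [s' [z [zw zc]]] : exists s' z,
    on_wall (n i) (delta i) (location (a i)) (g i) s' z /\ c 0 s' < z < c 0 s' + r.
  have [->|] := eqVneq i l1.
    exists s, x; split=> //; rewrite mxE eqxx.
    by move: xy; case: (ger0P (x - y)) => xy0 h; apply/andP; split; lra.
  rewrite eq_sym => /unlift_some[j iE _].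
  have [jE|jE] := eqVneq j j2.
    rewrite iE jE -l2E; exists s, y; split=> //; rewrite mxE eqxx.
    by move: xy; case: (ger0P (x - y)) => xy0 h; apply/andP; split; lra.
  have idxE : idx (tperm j2 s j) = i by rewrite /idx tpermK iE.
  exists (tperm j2 s j), (o (tperm j2 s j)); split.
    by rewrite /o idxE /on_wall subrr mul0r.
  rewrite mxE ifN; first by apply/andP; split; lra.
  by apply: contra jE => /eqP jE; rewrite -(tpermK j2 s j) jE tpermR.
have [m [k [Dk Ds]]] := GD.
apply: (@wall_cuts_cube _ _ _ _ _ _ _ (Cube c r0) _ _ _ (n2 i) _ zc (Dk s') Ds QD).
by apply: on_wall_refine zw => //; apply: gP; rewrite -Ds.
Qed.

(** * The common scale *)

Lemma phi_itv (R : realType) (n n' j : nat) : (2 <= n)%N -> (2 <= n')%N ->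
  (n'%:R ^+ phi R n n' j <= n%:R ^+ j :> R) && (n%:R ^+ j < n'%:R ^+ (phi R n n' j).+1 :> R).
Proof.
move=> n2 n'2.
have n1 : 1 < (n%:R : R) by rewrite ltr1n.
have n'1 : 1 < (n'%:R : R) by rewrite ltr1n.
have [n0 n'0] := (lt_trans ltr01 n1, lt_trans ltr01 n'1).
have [l l'] := (ln_gt0 n1, ln_gt0 n'1).
have q0 : 0 <= j%:R * ln n%:R / ln n'%:R :> R by rewrite divr_ge0 // ?mulr_ge0 // ltW.
have := truncn_itv q0; rewrite -/(phi R n n' j).
rewrite ler_pdivlMr // ltr_pdivrMr // !mulr_natl -!lnXn //.
by rewrite ler_ln ?posrE ?exprn_gt0 // ltr_ln ?posrE ?exprn_gt0.
Qed.

(** * Far numbers and far pairs as separation of walls *)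

Lemma on_wall_fineP (R : realType) (d n : nat) (delta : 'rV[R]_d)
    (L : nat -> 'rV[int]_d) (p : nat) (s : 'I_d) (x : R) : (2 <= n)%N ->
  on_wall n delta L p s x <-> exists k : int, x = delta 0 s + k%:~R / n%:R ^+ p.
Proof.
move=> n2; rewrite /on_wall /grid_origin lez_nat leq0n -exprnP.
have np0 : (n%:R : R) ^+ p != 0 by rewrite expf_neq0 // pnatr_eq0 -lt0n (leq_trans _ n2).
split=> [/intrP[k xk]|[k ->]].
  by exists k; rewrite -xk mulfK // subrKC.
by rewrite addrAC subrr add0r divfK ?intr_int.
Qed.

(** The hypothesis on [L] makes the formula correct for p = 0 too, where the origin
is [delta] itself. *)
Lemma on_wall_coarseP (R : realType) (d n : nat) (delta : 'rV[R]_d)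
    (L : nat -> 'rV[int]_d) (p : nat) (s : 'I_d) (x : R) : (2 <= n)%N -> L 0%N = 0 ->
  on_wall n delta L (- p%:Z) s x <->
  exists k : int, x = delta 0 s + (L p 0 s + k * n%:Z ^+ p)%:~R.
Proof.
move=> n2 L0; have n0 : (n%:R : R) != 0 by rewrite pnatr_eq0 -lt0n (leq_trans _ n2).
have np0 : (n%:R : R) ^+ p != 0 by rewrite expf_neq0.
rewrite /on_wall; have -> : grid_origin delta L (- p%:Z) = delta + map_mx intr (L p).
  by rewrite /grid_origin; case: p {np0} => [|p] //=; rewrite L0 map_mx0 addr0.
rewrite -exprnN !mxE -(rwP intrP).
have E k : (L p 0 s + k * n%:Z ^+ p)%:~R = (L p 0 s)%:~R + k%:~R * n%:R ^+ p :> R.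
  by rewrite intrD intrM rmorphXn.
split=> -[k xk]; exists k; rewrite ?xk E addrA.
  by rewrite -xk divfK // subrKC.
by rewrite [X in X - _]addrC addrK mulfK.
Qed.

Lemma walls_apart_fineP (R : realType) (d : nat) (n : 'I_d.+1 -> nat)
    (delta : 'I_d.+1 -> 'rV[R]_d) (L : 'I_d.+1 -> nat -> 'rV[int]_d)
    (p : 'I_d.+1 -> nat) (r : R) (l1 l2 : 'I_d.+1) (s : 'I_d) :
  (forall i, (2 <= n i)%N) ->
  walls_apart n delta L (fun i => p i) r l1 l2 s <->
  forall k1 k2 : int, r <= `|delta l1 0 s - delta l2 0 s
    - k1%:~R / (n l1)%:R ^+ p l1 - k2%:~R / (n l2)%:R ^+ p l2|.
Proof.
move=> n2; split=> [apart k1 k2|far x y].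
  have -> : delta l1 0 s - delta l2 0 s
    - k1%:~R / (n l1)%:R ^+ p l1 - k2%:~R / (n l2)%:R ^+ p l2 =
    (delta l1 0 s + (- k1)%:~R / (n l1)%:R ^+ p l1)
    - (delta l2 0 s + k2%:~R / (n l2)%:R ^+ p l2) by rewrite intrN; ring.
  by apply: apart; apply/on_wall_fineP => //; [exists (- k1) | exists k2].
move=> /on_wall_fineP -/(_ (n2 l1))[k1 ->] /on_wall_fineP -/(_ (n2 l2))[k2 ->].
by have := far (- k1) k2; congr (_ <= `|_|); rewrite intrN; ring.
Qed.

Lemma walls_apart_coarseP (R : realType) (d : nat) (n : 'I_d.+1 -> nat)
    (delta : 'I_d.+1 -> 'rV[R]_d) (L : 'I_d.+1 -> nat -> 'rV[int]_d)
    (p : 'I_d.+1 -> nat) (r : R) (l1 l2 : 'I_d.+1) (s : 'I_d) :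
  (forall i, (2 <= n i)%N) -> (forall i, L i 0%N = 0) ->
  walls_apart n delta L (fun i => - (p i)%:Z) r l1 l2 s <->
  forall k1 k2 : int, r <= `|delta l1 0 s - delta l2 0 s
    + (L l1 (p l1) 0 s + k1 * (n l1)%:Z ^+ p l1
       - L l2 (p l2) 0 s - k2 * (n l2)%:Z ^+ p l2)%:~R|.
Proof.
move=> n2 L0.
have E k1 k2 : delta l1 0 s - delta l2 0 s
    + (L l1 (p l1) 0 s + k1 * (n l1)%:Z ^+ p l1
       - L l2 (p l2) 0 s - k2 * (n l2)%:Z ^+ p l2)%:~R =
    (delta l1 0 s + (L l1 (p l1) 0 s + k1 * (n l1)%:Z ^+ p l1)%:~R)
    - (delta l2 0 s + (L l2 (p l2) 0 s + k2 * (n l2)%:Z ^+ p l2)%:~R).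
  by rewrite !intrB !intrD; ring.
split=> [apart k1 k2|far x y].
  by rewrite E; apply: apart; apply/on_wall_coarseP => //; [exists k1 | exists k2].
move=> /on_wall_coarseP -/(_ (n2 l1) (L0 l1))[k1 ->].
by move=> /on_wall_coarseP -/(_ (n2 l2) (L0 l2))[k2 ->]; rewrite -E.
Qed.

(** * From adjacency to the arithmetic conditions *)

Lemma location0 (d n : nat) (a : nat -> 'rV['I_n]_d) : location a 0 = 0.
Proof. by rewrite /location big_ord0. Qed.

(** The threshold works for all bases at once, which matters because the threshold
in a far pair has to be the same for all elements of the collection. *)
Lemma pow_eventually_ge (R : realType) (B : R) :
  exists J : nat, forall b j : nat, (2 <= b)%N -> (J <= j)%N -> B <= b%:R ^+ j.
Proof.
exists (Num.bound B) => b j b2 Jj.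
apply/(le_trans (ltW (upper_nthrootP Jj))).
by apply: lerXn2r; rewrite ?nnegrE ?ler0n ?ler_nat.
Qed.

(** A cube of side nl^(-m) / C must be covered by a grid cube of side at most nl^(-m),
which is of generation at least phi(m) in its grid. *)
Lemma far_number_of_adjacent (R : realType) (d : nat) (n : 'I_d.+1 -> nat)
    (delta : 'I_d.+1 -> 'rV[R]_d) (a : forall i : 'I_d.+1, nat -> 'rV['I_(n i)]_d)
    (l1 l2 : 'I_d.+1) (s : 'I_d) : (forall i, (2 <= n i)%N) ->
  adjacent (fun i => grid (n i) (delta i) (location (a i))) -> l1 != l2 ->
  far_number (codom n) (n l1) (n l2) (delta l1 0 s - delta l2 0 s).
Proof.
move=> n2 [C C0 adj] l12; exists C^-1; first by rewrite invr_gt0.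
move=> _ /codomP[i0 ->] m; set b := n i0.
have bm : 0 < (b%:R : R) ^+ m by rewrite exprn_gt0 // ltr0n (leq_trans _ (n2 i0)).
apply/(walls_apart_fineP delta (fun i => location (a i)) (fun i => phi R b (n i) m)) => //.
apply: (walls_apart_of_adjacent n2 adj) => //; first by rewrite divr_gt0 ?invr_gt0.
move=> i z; rewrite mulrA mulfV ?gt_eqF // !mul1r.
have ni : 1 < ((n i)%:R : R) by rewrite ltr1n n2.
have niz : 0 < (n i)%:R ^ z :> R by rewrite exprz_gt0 // (lt_trans _ ni).
rewrite lef_pV2 ?posrE // => le_bz.
have /andP[lb _] := phi_itv R m (n2 i0) (n2 i).
by have := le_trans lb le_bz; rewrite -/b exprnP ler_eXz2l.
Qed.

(** The walls are at distance at least nl^j / C; for large j half of this dominates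
the difference of the delta's, and the other half is left to the integers. *)
Lemma far_pair_of_adjacent (R : realType) (d : nat) (n : 'I_d.+1 -> nat)
    (delta : 'I_d.+1 -> 'rV[R]_d) (a : forall i : 'I_d.+1, nat -> 'rV['I_(n i)]_d)
    (l1 l2 : 'I_d.+1) (s : 'I_d) : (forall i, (2 <= n i)%N) ->
  adjacent (fun i => grid (n i) (delta i) (location (a i))) -> l1 != l2 ->
  far_pair R (codom n) (n l1) (n l2)
    (fun j => location (a l1) j 0 s) (fun j => location (a l2) j 0 s).
Proof.
move=> n2 [C C0 adj] l12.
have [J JP] := pow_eventually_ge (2 * C * `|delta l1 0 s - delta l2 0 s|).
exists (2 * C)^-1, J; split; first by rewrite invr_gt0 mulr_gt0.
move=> _ /codomP[i0 ->] j Jj k1 k2; set b := n i0.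
have bj : 0 < (b%:R : R) ^+ j by rewrite exprn_gt0 // ltr0n (leq_trans _ (n2 i0)).
have /walls_apart_coarseP : walls_apart n delta (fun i => location (a i))
    (fun i => - (phi R b (n i) j)%:Z) (C^-1 * b%:R ^+ j) l1 l2 s.
  apply: (walls_apart_of_adjacent n2 adj) => //; first by rewrite mulr_gt0 ?invr_gt0.
  move=> i z; rewrite mulrA mulfV ?gt_eqF // !mul1r invr_expz => le_zb.
  have ni : 1 < ((n i)%:R : R) by rewrite ltr1n n2.
  have /andP[_ ub] := phi_itv R j (n2 i0) (n2 i).
  have := le_lt_trans le_zb ub; rewrite -/b exprnP ltr_eXz2l // -addn1 PoszD ltzD1.
  by rewrite lerNl.
move=> /(_ n2 (fun i => location0 (a i)) k1 k2) apart.
have := JP b j (n2 i0) Jj; rewrite -ler_pdivlMl ?mulr_gt0 // => small.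
have split_C : C^-1 * b%:R ^+ j = (2 * C)^-1 * b%:R ^+ j + (2 * C)^-1 * b%:R ^+ j :> R.
  by field; rewrite gt_eqF.
have := le_trans apart (ler_normD _ _); rewrite split_C => le_sum.
by rewrite intr_norm -(lerD2l ((2 * C)^-1 * b%:R ^+ j)) (le_trans le_sum) // lerD2r.
Qed.

(** * From the arithmetic conditions to adjacency *)

Lemma uniform_pos_bound (R : realType) (T : finType) (P : T -> R -> Prop) :
  (forall x c c', c' <= c -> P x c -> P x c') ->
  (forall x, exists2 c, 0 < c & P x c) -> exists2 c, 0 < c & forall x, P x c.
Proof.
move=> Pmono /fin_all_exists2[c c0 Pc].
exists (\big[Num.min/1]_x c x); last by move=> x; apply: Pmono (Pc x); apply: bigmin_le_cond.
by elim/big_ind: _ => // x y x0 y0; rewrite lt_min x0.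
Qed.

Lemma walls_apart_le (R : realType) (d : nat) (n : 'I_d.+1 -> nat)
    (delta : 'I_d.+1 -> 'rV[R]_d) (L : 'I_d.+1 -> nat -> 'rV[int]_d)
    (g : 'I_d.+1 -> int) (r r' : R) (l1 l2 : 'I_d.+1) (s : 'I_d) : r' <= r ->
  walls_apart n delta L g r l1 l2 s -> walls_apart n delta L g r' l1 l2 s.
Proof. by move=> r'r apart x y xw yw; apply: le_trans r'r _; apply: apart. Qed.

(** Far numbers come with one constant for each pair of grids and each coordinate;
there are finitely many, so their minimum serves for all. *)
Lemma fine_walls_apart (R : realType) (d : nat) (n : 'I_d.+1 -> nat)
    (delta : 'I_d.+1 -> 'rV[R]_d) (L : 'I_d.+1 -> nat -> 'rV[int]_d) (b : nat) :
  (forall i, (2 <= n i)%N) -> b \in codom n ->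
  (forall (l1 l2 : 'I_d.+1) (s : 'I_d), l1 != l2 ->
     far_number (codom n) (n l1) (n l2) (delta l1 0 s - delta l2 0 s)) ->
  exists2 c : R, 0 < c & forall (m : nat) (l1 l2 : 'I_d.+1) (s : 'I_d), l1 != l2 ->
    walls_apart n delta L (fun i => phi R b (n i) m) (c / b%:R ^+ m) l1 l2 s.
Proof.
move=> n2 bn far.
pose P (t : 'I_d.+1 * 'I_d.+1 * 'I_d) (c : R) := t.1.1 != t.1.2 -> forall m,
  walls_apart n delta L (fun i => phi R b (n i) m) (c / b%:R ^+ m) t.1.1 t.1.2 t.2.
have [||c c0 Pc] := @uniform_pos_bound R _ P.
- move=> t c c' c'c Pc l12 m; apply: walls_apart_le (Pc l12 m).
  by rewrite ler_wpM2r // invr_ge0 exprn_ge0.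
- move=> [[l1 l2] s]; have [->|l12] := eqVneq l1 l2.
    by exists 1 => //; rewrite /P eqxx.
  have [c c0 cP] := far l1 l2 s l12; exists c => // _ m.
  by apply/walls_apart_fineP => //; apply: cP.
by exists c => // m l1 l2 s l12; apply: (Pc (l1, l2, s)).
Qed.

(** The delta's shift the walls by a bounded amount, which half of the far pair
separation absorbs from some j on. *)
Lemma coarse_walls_apart (R : realType) (d : nat) (n : 'I_d.+1 -> nat)
    (delta : 'I_d.+1 -> 'rV[R]_d) (L : 'I_d.+1 -> nat -> 'rV[int]_d) (b : nat) :
  (forall i, (2 <= n i)%N) -> (forall i, L i 0%N = 0) -> b \in codom n ->
  (forall (l1 l2 : 'I_d.+1) (s : 'I_d), l1 != l2 ->
     far_pair R (codom n) (n l1) (n l2) (fun j => L l1 j 0 s) (fun j => L l2 j 0 s)) ->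
  exists (c : R) (J : nat), 0 < c /\
    forall (j : nat) (l1 l2 : 'I_d.+1) (s : 'I_d), (J <= j)%N -> l1 != l2 ->
    walls_apart n delta L (fun i => - (phi R b (n i) j)%:Z) (c * b%:R ^+ j) l1 l2 s.
Proof.
move=> n2 L0 bn far.
pose Q (t : 'I_d.+1 * 'I_d.+1 * 'I_d) (c : R) (J : nat) :=
  t.1.1 != t.1.2 -> forall j, (J <= j)%N ->
  walls_apart n delta L (fun i => - (phi R b (n i) j)%:Z) (c * b%:R ^+ j) t.1.1 t.1.2 t.2.
have [||c c0 Pc] := @uniform_pos_bound R _ (fun t c => exists J, Q t c J).
- move=> t c c' c'c [J QJ]; exists J => l12 j Jj; apply: walls_apart_le (QJ l12 j Jj).
  by rewrite ler_wpM2r // exprn_ge0.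
- move=> [[l1 l2] s]; have [->|l12] := eqVneq l1 l2.
    by exists 1 => //; exists 0%N; rewrite /Q eqxx.
  have [c [J [c0 cP]]] := far l1 l2 s l12; exists (c / 2); first by rewrite divr_gt0.
  have b2 : (2 <= b)%N by case/codomP: bn => i ->.
  have [J' J'P] := pow_eventually_ge ((c / 2)^-1 * `|delta l1 0 s - delta l2 0 s|).
  exists (maxn J J') => _ j; rewrite geq_max => /andP[Jj J'j].
  apply/walls_apart_coarseP => // k1 k2 /=.
  have := J'P b j b2 J'j; rewrite ler_pdivrMl ?divr_gt0 // => small.
  set I := (_ + _ - _ - _)%:~R.
  have big : c * b%:R ^+ j <= `|I| by rewrite -intr_norm; apply: cP.
  have := lerB_normD I (delta l1 0 s - delta l2 0 s); rewrite [I + _]addrC => low.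
  by apply: le_trans low; lra.
have {Pc} [J QJ] := fin_all_exists Pc.
exists c, (\max_t J t)%N; split=> // j l1 l2 s Jj l12; apply: (QJ (l1, l2, s)) => //.
exact: leq_trans (leq_bigmax _) Jj.
Qed.

(** Every side of a cube is matched, up to a constant, by a scale on which the walls
are separated: a power b^(-m) for sides at most c, and b^j with j >= J for larger
ones. *)
Lemma adjacent_of_far (R : realType) (d : nat) (n : 'I_d.+1 -> nat)
    (delta : 'I_d.+1 -> 'rV[R]_d) (L : 'I_d.+1 -> nat -> 'rV[int]_d) :
  (forall i, (2 <= n i)%N) -> (forall i, L i 0%N = 0) ->
  (forall (l1 l2 : 'I_d.+1) (s : 'I_d), l1 != l2 ->
     far_number (codom n) (n l1) (n l2) (delta l1 0 s - delta l2 0 s)) ->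
  (forall (l1 l2 : 'I_d.+1) (s : 'I_d), l1 != l2 ->
     far_pair R (codom n) (n l1) (n l2) (fun j => L l1 j 0 s) (fun j => L l2 j 0 s)) ->
  adjacent (fun i => grid (n i) (delta i) (L i)).
Proof.
move=> n2 L0 farN farP; pose b := n ord0.
have [c c0 fine] := fine_walls_apart L n2 (codom_f n ord0) farN.
have [c' [J [c'0 coarse]]] := coarse_walls_apart delta n2 L0 (codom_f n ord0) farP.
rewrite -/b in fine coarse.
have b1 : 1 < (b%:R : R) by rewrite ltr1n; apply: n2.
have b0 : 0 < (b%:R : R) := lt_trans ltr01 b1.
pose M : R := \sum_i (n i)%:R.
have nM i : (n i)%:R <= M.
  by rewrite /M (bigD1 i) //= lerDl sumr_ge0 // => k _; rewrite ler0n.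
have M0 : 0 < M by apply: lt_le_trans b0 (nM ord0).
(* The three terms bound the ratio of sides, respectively, for small cubes, for cubes
   larger than c that the first coarse scale J already covers, and for cubes
   that need a scale beyond J. *)
pose C := M * b%:R / c + b%:R ^+ J / c + b%:R / c'.
have [C1 C2 C3] : [/\ 0 < M * b%:R / c, 0 < b%:R ^+ J / c & 0 < b%:R / c'].
  by split; rewrite divr_gt0 ?mulr_gt0 ?exprn_gt0.
have C0 : 0 < C by rewrite !addr_gt0.
have leC1 : M * b%:R / c <= C by rewrite /C -addrA lerDl ltW ?addr_gt0.
have leC2 : b%:R ^+ J / c <= C by rewrite /C addrAC lerDr ltW ?addr_gt0.
have leC3 : b%:R / c' <= C by rewrite /C lerDr ltW ?addr_gt0.
exists C => //.
move=> Q; have Q0 := side_gt0 Q.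
suff [g [r [apart Qr bound]]] : exists (g : 'I_d.+1 -> int) (r : R),
    [/\ forall l1 l2 s, l1 != l2 -> walls_apart n delta L g r l1 l2 s, side Q <= r
      & forall i, 1 / (n i)%:R ^ g i <= C * side Q].
  have [i [D [GD QD Ds]]] := cube_in_grid_of_walls_apart n2 apart Qr.
  by exists i, D; split=> //; rewrite Ds.
have [Qc|cQ] := lerP (side Q) c.
- have [K KP] := pow_eventually_ge (c / side Q).
  have ex : exists m, c / b%:R ^+ m.+1 < side Q.
    exists K; rewrite ltr_pdivrMr ?exprn_gt0 // mulrC -ltr_pdivrMr //.
    by apply: le_lt_trans (KP b K (n2 _) (leqnn _)) _; rewrite ltr_eXn2l.
  (* The finest scale at which the walls are still separated by the side of Q. *)
  case: (ex_minnP ex) => m ltQ minm.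
  exists (fun i => phi R b (n i) m), (c / b%:R ^+ m); split.
  + by move=> l1 l2 s; apply: fine.
  + case: m minm ltQ => [|m] minm _; first by rewrite expr0 divr1.
    by rewrite leNgt; apply/negP => /minm; rewrite ltnn.
  move=> i; rewrite div1r -exprnP.
  have /andP[_ ub] := phi_itv R m (n2 ord0) (n2 i); rewrite -/b exprS in ub.
  have ni0 : 0 < (n i)%:R :> R by rewrite ltr0n (leq_trans _ (n2 i)).
  apply: (@le_trans _ _ (M * b%:R / c * side Q)); last first.
    by rewrite ler_pM2r.
  apply: (@le_trans _ _ (M / b%:R ^+ m)).
    rewrite ler_pdivlMr ?exprn_gt0 // mulrC ler_pdivrMr ?exprn_gt0 //.
    by apply: le_trans (ltW ub) _; rewrite ler_pM2r ?exprn_gt0.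
  rewrite -!mulrA ler_pM2l // mulrCA ler_pdivlMl // ler_pdivrMr ?exprn_gt0 //.
  move: ltQ; rewrite ltr_pdivrMr ?exprn_gt0 // exprS mulrA => /ltW.
  by rewrite [b%:R * _]mulrC.
have [K KP] := pow_eventually_ge (side Q / c').
have ex : exists j, (J <= j)%N && (side Q <= c' * b%:R ^+ j).
  exists (maxn J K); rewrite leq_maxl mulrC -ler_pdivrMr //.
  by apply: KP (leq_maxr _ _); apply: n2.
case: (ex_minnP ex) => j /andP[Jj leQ] minj.
exists (fun i => - (phi R b (n i) j)%:Z), (c' * b%:R ^+ j); split=> //.
  by move=> l1 l2 s; apply: coarse.
move=> i; rewrite -exprnN invrK mul1r.
have /andP[lb _] := phi_itv R j (n2 ord0) (n2 i); rewrite -/b in lb.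
apply: (le_trans lb).
move: Jj; rewrite leq_eqVlt => /orP[/eqP JE|].
  apply: (@le_trans _ _ (b%:R ^+ J / c * side Q)); last first.
    by rewrite ler_pM2r.
  by rewrite -JE -mulrA ler_peMr ?exprn_ge0 ?ltW // mulrC ltr_pdivlMr ?mul1r.
case: j leQ minj lb => // j leQ minj lb Jj.
apply: (@le_trans _ _ (b%:R / c' * side Q)); last by rewrite ler_pM2r.
rewrite exprS -mulrA ler_pM2l // ler_pdivlMl // ltW // ltNge.
apply/negP => Qj; have /minj : (J <= j)%N && (side Q <= c' * b%:R ^+ j).
  by rewrite Qj andbT -ltnS.
by rewrite ltnn.
Qed.

Theorem theorem1p11 (R : realType) (d : nat) (hd : (1 <= d)%N)
    (n : 'I_d.+1 -> nat) (hn : forall i, (2 <= n i)%N)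
    (delta : 'I_d.+1 -> 'rV[R]_d)
    (a : forall i : 'I_d.+1, nat -> 'rV['I_(n i)]_d) :
  adjacent (fun i => grid (n i) (delta i) (location (a i)))
  <->
  ((forall (l1 l2 : 'I_d.+1) (s : 'I_d), l1 != l2 ->
      far_number (codom n) (n l1) (n l2) (delta l1 0 s - delta l2 0 s))
   /\
   (forall (l3 l4 : 'I_d.+1) (s : 'I_d), l3 != l4 ->
      far_pair R (codom n) (n l3) (n l4)
        (fun j => location (a l3) j 0 s) (fun j => location (a l4) j 0 s))).
Proof.
split=> [adj|[farN farP]].
  by split=> l1 l2 s;
    [exact: far_number_of_adjacent hn adj | exact: far_pair_of_adjacent hn adj].
by apply: adjacent_of_far => // i; apply: location0.
Qed.
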